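(* For every $n\ge 2$ and every choice $C\in\mathcal{C}^n$, the multiplication on $OH^n$ defined by $C$ (that is, the multiplication of $OH^n_C$) is not associative.
   Context: Matchings. $B^n$ is the set of crossingless matchings of $2n$ points on a horizontal line by non-crossing arcs placed below the line. For $b\in B^n$, $W(b)$ is the reflection of $b$ across the line, and $W(b)a$ is the gluing of $W(b)$ on top of $a$, a disjoint union of circles; $|W(b)a|$ is the number of circles. $W(c)bW(b)a$ denotes the disjoint union of $W(c)b$ placed on top of $W(b)a$. Odd arc algebra. For a disjoint union $S$ of circles, $V(S)$ is the free abelian group on the components of $S$, each of degree $2$, and $OF(S)=\bigwedge^*V(S)\{-|S|\}$, where $\{m\}$ shifts the degree up by $m$. Put $b(OH^n)a:=OF(W(b)a)\{n\}$ and $OH^n=\bigoplus_{a,b\in B^n}b(OH^n)a$. For $a,b,c\in B^n$, a choice $C_{cba}$ is a cobordism $W(c)bW(b)a\to W(c)a$ obtained by contracting, by one saddle each, every arc of $b$ with its mirror image in $W(b)$ (replacing the two arcs by two vertical strands), together with (i) an order in which these $n$ saddles are performed, no arc being contracted before an arc surrounding it, and (ii) for each saddle that splits a circle into two, an orientation, i.e. an ordering $b_1\to b_2$ of the two resulting circles. $\mathcal{C}^n$ is the set of all choices $C=\{C_{cba}\mid a,b,c\in B^n\}$. $OF(C_{cba}):OF(W(c)bW(b)a)\to OF(W(c)a)$ is the composite of the maps of the saddles: a merge of $a_1,a_2$ acts by the map of exterior algebras identifying $a_1$ with $a_2$; a split of $a$ into $b_1\to b_2$ replaces each occurrence of $a$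 by $b_1$ and then multiplies on the left by $(b_1-b_2)\wedge$. The product of $x\in c(OH^n)b$ and $y\in b(OH^n)a$ is $xy:=OF(C_{cba})(x\wedge y)\in c(OH^n)a$; the product $d(OH^n)c\otimes b(OH^n)a\to OH^n$ is zero if $c\neq b$. $OH^n_C$ is $OH^n$ with this multiplication. *)

(* Defs.v *)
From HB Require Import structures.
From mathcomp Require Import all_boot all_order all_algebra ring.

Set Implicit Arguments.
Unset Strict Implicit.
Unset Printing Implicit Defensive.

Import GRing.Theory.
Local Open Scope ring_scope.

Section Exterior.
Variable T : finType.

(* The exterior algebra of the free abelian group on T: x A is the coefficient
   of x at the wedge product of the elements of A, taken in the order of enum T
   (lemmas ext_sum and ebaseE). *)
Definition ext := {ffun {set T} -> int}.
HB.instance Definition _ := GRing.Zmodule.on ext.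

Implicit Types (x y z : ext) (A B D U : {set T}).

Definition inversions A B : nat :=
  (\sum_(s in A) \sum_(t in B) (enum_rank t < enum_rank s))%N.

Definition ebase A : ext := [ffun U => (U == A)%:R].

Definition wedge x y : ext :=
  [ffun U : {set T} => \sum_(A : {set T} | A \subset U)
     (-1) ^+ inversions A (U :\: A) * x A * y (U :\: A)].

Lemma inversionsUl A B D : [disjoint A & B] ->
  inversions (A :|: B) D = (inversions A D + inversions B D)%N.
Proof.
by move=> dAB; rewrite /inversions -bigU //; apply: eq_bigl => t; rewrite !inE.
Qed.

Lemma inversionsUr A B D : [disjoint B & D] ->
  inversions A (B :|: D) = (inversions A B + inversions A D)%N.
Proof.
move=> dBD; rewrite /inversions -big_split /=.
by apply: eq_bigr => i _; rewrite -bigU //; apply: eq_bigl => t; rewrite !inE.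
Qed.

Lemma inversions0l A : inversions set0 A = 0%N.
Proof. by rewrite /inversions big_set0. Qed.

Lemma inversions0r A : inversions A set0 = 0%N.
Proof. by rewrite /inversions big1 // => i _; rewrite big_set0. Qed.

Lemma wedgeA : associative wedge.
Proof.
move=> x y z; apply/ffunP=> U; rewrite !ffunE.
pose F (A B : {set T}) : int :=
  (-1) ^+ (inversions A B + inversions A (U :\: (A :|: B)) +
   inversions B (U :\: (A :|: B))) * x A * y B * z (U :\: (A :|: B)).
transitivity (\sum_(A : {set T} | A \subset U)
    \sum_(B : {set T} | B \subset U :\: A) F A B).
  apply: eq_bigr => A sAU; rewrite ffunE big_distrr /=.
  apply: eq_bigr => B sB; rewrite /F setDDl.
  have -> : inversions A (U :\: A) =
    (inversions A B + inversions A (U :\: (A :|: B)))%N.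
    rewrite -inversionsUr.
      congr inversions; apply/setP=> t; rewrite !inE negb_or.
      have := subsetP sB t; rewrite !inE.
      by case: (t \in B); case: (t \in A); case: (t \in U) => //= /(_ isT).
    rewrite disjoint_sym -setI_eq0; apply/eqP/setP=> t.
    by rewrite !inE; case: (t \in B); rewrite ?orbT ?andbF.
  rewrite !exprD; ring.
symmetry.
transitivity (\sum_(D : {set T} | D \subset U)
    \sum_(A : {set T} | A \subset D) F A (D :\: A)).
  apply: eq_bigr => D sDU; rewrite ffunE big_distrr big_distrl /=.
  apply: eq_bigr => A sA; rewrite /F.
  have DE : A :|: D :\: A = D.
    apply/setP=> t; rewrite !inE; have := subsetP sA t.
  by case: (t \in A) => //= ->.
  have dA : [disjoint A & D :\: A].
    by rewrite -setI_eq0; apply/eqP/setP=> t; rewrite !inE; case: (t \in A).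
  have -> : inversions D (U :\: D) =
      (inversions A (U :\: D) + inversions (D :\: A) (U :\: D))%N.
    by rewrite -inversionsUl // DE.
  rewrite DE !exprD; ring.
rewrite (exchange_big_dep (fun A : {set T} => A \subset U)) /=; last first.
  by move=> D A sDU sAD; apply: subset_trans sDU.
apply: eq_bigr => A sAU.
rewrite (reindex_onto (fun B : {set T} => A :|: B) (fun D => D :\: A)) /=;
  last first.
  move=> D /andP[_ sA].
  apply/setP=> t; rewrite !inE; have := subsetP sA t.
  by case: (t \in A) => //= ->.
apply: eq_big => [B|B /andP[_ /eqP->] //].
rewrite subUset sAU subsetUl andbT /= subsetD; apply: andb_id2l => _.
rewrite setDUl setDv set0U; apply/eqP/idP => [<-|dBA].
  by rewrite -setI_eq0; apply/eqP/setP=> t; rewrite !inE andbAC andNb.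
by apply/setDidPl.
Qed.

Lemma wedge1l : left_id (ebase set0) wedge.
Proof.
move=> x; apply/ffunP=> U; rewrite !ffunE (bigD1 set0) ?sub0set //= big1.
  by rewrite ffunE eqxx setD0 inversions0l !mul1r addr0.
by move=> A /andP[_ /negPf nA]; rewrite ffunE nA mulr0 mul0r.
Qed.

Lemma wedge1r : right_id (ebase set0) wedge.
Proof.
move=> x; apply/ffunP=> U; rewrite !ffunE (bigD1 U) //= big1.
  by rewrite ffunE setDv eqxx inversions0r mul1r mulr1 addr0.
move=> A /andP[sAU nAU]; rewrite ffunE setD_eq0.
by rewrite (_ : U \subset A = false) ?mulr0 //; apply: contraNF nAU => sUA;
   rewrite eqEsubset sAU.
Qed.

Lemma wedgeDl : left_distributive wedge +%R.
Proof.
move=> x y z; apply/ffunP=> U; rewrite !ffunE -big_split /=.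
by apply: eq_bigr => A _; rewrite !ffunE mulrDr mulrDl.
Qed.

Lemma wedgeDr : right_distributive wedge +%R.
Proof.
move=> x y z; apply/ffunP=> U; rewrite !ffunE -big_split /=.
by apply: eq_bigr => A _; rewrite !ffunE mulrDr.
Qed.

Lemma ebase0_neq0 : ebase set0 != 0.
Proof. by apply/eqP=> /ffunP/(_ set0); rewrite !ffunE eqxx. Qed.

HB.instance Definition _ := GRing.Zmodule_isNzRing.Build ext
  wedgeA wedge1l wedge1r wedgeDl wedgeDr ebase0_neq0.

Definition gen (t : T) : ext := ebase [set t].

Lemma ebaseM A B : ebase A * ebase B =
  if [disjoint A & B] then ebase (A :|: B) *~ (-1) ^+ inversions A B else 0.
Proof.
apply/ffunP=> U.
have -> : (ebase A * ebase B) U =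
    (A \subset U)%:R * (U :\: A == B)%:R * (-1) ^+ inversions A B.
  rewrite ffunE; case sAU: (A \subset U); last first.
    rewrite !mul0r big1 // => D sDU; rewrite !ffunE.
    by case: eqP sDU sAU => [->->|]; rewrite ?mulr0 ?mul0r.
  rewrite (bigD1 A) //= big1 ?addr0 => [|D /andP[_ /negPf nD]]; last first.
    by rewrite ffunE nD mulr0 mul0r.
  rewrite !ffunE eqxx.
  by case: eqP => [->|_]; rewrite ?mulr0 ?mul0r ?mulr1 ?mul1r.
case: ifPn => [dAB|ndAB].
  rewrite ffunMzE mulrzz ffunE; congr (_ * _).
  rewrite -natrM mulnb; congr (nat_of_bool _)%:R.
  apply/idP/eqP => [/andP[sAU /eqP<-]|->].
    apply/setP=> t; rewrite !inE; have := subsetP sAU t.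
    by case: (t \in A) => // ->.
  rewrite subsetUl /=.
  by rewrite setDUl setDv set0U; apply/eqP/setDidPl; rewrite disjoint_sym.
rewrite [RHS]ffunE; case: eqP ndAB => [<-|_]; rewrite ?mulr0 ?mul0r //.
rewrite -setI_eq0 (_ : A :&: (U :\: A) = set0) ?eqxx //.
by apply/setP=> t; rewrite !inE andbA andbN.
Qed.

Lemma gen_sq t : gen t * gen t = 0.
Proof. by rewrite ebaseM disjoints1 inE eqxx. Qed.

Lemma genC s t : gen s * gen t = - (gen t * gen s).
Proof.
have [->|nst] := eqVneq s t; first by rewrite gen_sq oppr0.
rewrite !ebaseM !disjoints1 !inE (eq_sym t s) nst setUC /inversions !big_set1.
have : (enum_rank s != enum_rank t :> nat).
  by rewrite (inj_eq val_inj) (inj_eq enum_rank_inj).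
by rewrite neq_ltn => /orP[h|h]; rewrite h ltnNge (ltnW h) /= ?opprK.
Qed.

Let lt (s t : T) := (enum_rank s < enum_rank t)%N.

Lemma enum_rank_lt_trans : transitive lt.
Proof. by move=> t s u; apply: ltn_trans. Qed.

Lemma enum_rank_lt_irr : irreflexive lt.
Proof. by move=> t; apply: ltnn. Qed.

Lemma pairwise_enum A : pairwise lt (enum A).
Proof.
rewrite /enum_mem; apply: pairwise_filter; rewrite -enumT.
case: (pickP T) => [x0 _|T0]; last first.
  by rewrite (size0nil (s := enum T)) // -cardE; apply: eq_card0.
have rk i : (i < size (enum T))%N -> enum_rank (nth x0 (enum T) i) = i :> nat.
  move=> lti; have := nth_enum_rank x0 (nth x0 (enum T) i).
  move/eqP; rewrite nth_uniq ?enum_uniq //; first by move/eqP.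
  by rewrite -cardE.
apply/(pairwiseP x0) => i j lti ltj ltij.
by rewrite /lt !rk.
Qed.

Lemma prod_gen_pairwise (l : seq T) :
  pairwise lt l -> \prod_(t <- l) gen t = ebase [set t in l].
Proof.
elim: l => [_|t l IH /= /andP[/allP tl pl]].
  by rewrite big_nil; congr ebase; apply/setP=> t; rewrite !inE.
rewrite big_cons IH // ebaseM disjoints1 inE.
have -> /= : t \notin l by apply/negP=> /tl; rewrite /lt ltnn.
rewrite /inversions big_set1 big1 => [|s]; last first.
  by rewrite inE => /tl lts; rewrite ltnNge (ltnW lts).
by rewrite expr0 mulr1z; congr ebase; apply/setP=> s; rewrite !inE.
Qed.

Lemma ebaseE A : ebase A = \prod_(t <- enum A) gen t.
Proof.
rewrite prod_gen_pairwise ?pairwise_enum //; congr ebase.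
by apply/setP=> t; rewrite inE mem_enum.
Qed.

Lemma ext_sum x : x = \sum_(A : {set T}) ebase A *~ x A.
Proof.
apply/ffunP=> U; rewrite sum_ffunE (bigD1 U) //= big1 ?addr0.
  by rewrite ffunMzE ffunE eqxx mulrzz mul1r.
by move=> A /negPf nA; rewrite ffunMzE ffunE eq_sym nA mul0rz.
Qed.

End Exterior.

(* The map of exterior algebras induced by a map of generators. *)
Section ExteriorMap.
Variables (T T' : finType) (f : T -> T').

Definition extmap (x : ext T) : ext T' :=
  \sum_(A : {set T}) (\prod_(t <- enum A) gen (f t)) *~ x A.

Lemma extmap_is_zmod_morphism : zmod_morphism extmap.
Proof.
move=> x y; rewrite /extmap -sumrB; apply: eq_bigr => A _.
by rewrite !ffunE mulrzBr.
Qed.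

HB.instance Definition _ :=
  GRing.isZmodMorphism.Build (ext T) (ext T') extmap extmap_is_zmod_morphism.

Lemma extmap_ebase A : extmap (ebase A) = \prod_(t <- enum A) gen (f t).
Proof.
rewrite /extmap (bigD1 A) //= [X in _ + X]big1 ?addr0.
  by rewrite ffunE eqxx mulr1z.
by move=> B /negPf nB; rewrite ffunE nB mulr0z.
Qed.

Lemma extmap_gen t : extmap (gen t) = gen (f t).
Proof. by rewrite extmap_ebase enum_set1 big_seq1. Qed.

Let lt (s t : T) := (enum_rank s < enum_rank t)%N.

Let extmap_pairwise l : pairwise lt l ->
  extmap (\prod_(t <- l) gen t) = \prod_(t <- l) gen (f t).
Proof.
move=> pl; rewrite prod_gen_pairwise // extmap_ebase.
congr (\big[_/_]_(t <- _) _); apply: (irr_sorted_eq (leT := lt)).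
- exact: enum_rank_lt_trans.
- exact: enum_rank_lt_irr.
- exact/pairwise_sorted/pairwise_enum.
- exact: pairwise_sorted.
- by move=> t; rewrite mem_enum inE.
Qed.

Let gen_insert t l : pairwise lt l ->
  exists (k : int) (l' : seq T), [/\ pairwise lt l', {subset l' <= t :: l},
    gen t * \prod_(s <- l) gen s = (\prod_(s <- l') gen s) *~ k &
    gen (f t) * \prod_(s <- l) gen (f s) = (\prod_(s <- l') gen (f s)) *~ k].
Proof.
elim: l => [_|u l IH pul].
  by exists 1, [:: t]; split; rewrite ?big_seq1 ?big_nil ?mulr1.
have /andP[/allP ul pl] := pul.
have [ltu|ltu|etu] := ltngtP (enum_rank t) (enum_rank u).
- exists 1, [:: t, u & l]; split; rewrite ?mulr1z ?big_cons //.
  apply/andP; split=> //; apply/allP=> s; rewrite inE => /orP[/eqP->//|/ul].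
  by move=> lus; apply: ltn_trans ltu lus.
- have [k [l' [pl' sl' e1 e2]]] := IH pl.
  exists (- k), (u :: l'); split.
  + apply/andP; split=> //; apply/allP=> s /sl'.
    by rewrite inE => /orP[/eqP->|/ul].
  + move=> s; rewrite !inE => /orP[->|/sl']; rewrite ?orbT //.
    by rewrite inE => /orP[->|->]; rewrite ?orbT.
  + by rewrite !big_cons mulrA genC mulNr -mulrA e1 mulrNz mulrzAr.
  + by rewrite !big_cons mulrA genC mulNr -mulrA e2 mulrNz mulrzAr.
- exists 0, [::]; rewrite !mulr0z; split=> //.
  + by rewrite big_cons mulrA (enum_rank_inj (val_inj etu)) gen_sq mul0r.
  + by rewrite big_cons mulrA (enum_rank_inj (val_inj etu)) gen_sq mul0r.
Qed.

Let extmap_genM t x : extmap (gen t * x) = gen (f t) * extmap x.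
Proof.
rewrite (ext_sum x) mulr_sumr !raddf_sum mulr_sumr; apply: eq_bigr => A _ /=.
rewrite mulrzAr !raddfMz /= mulrzAr; congr (_ *~ _).
rewrite extmap_ebase ebaseE.
have [k [l [pl _ -> ->]]] := gen_insert t (pairwise_enum A).
by rewrite raddfMz /= extmap_pairwise.
Qed.

Lemma extmap_is_monoid_morphism : monoid_morphism extmap.
Proof.
split=> [|x y].
  by rewrite [1]/(ebase set0) extmap_ebase enum_set0 big_nil.
rewrite (ext_sum x) mulr_suml !raddf_sum mulr_suml; apply: eq_bigr => A _ /=.
rewrite mulrzAl !raddfMz /= mulrzAl; congr (_ *~ _).
rewrite extmap_ebase ebaseE; elim: (enum A) => [|t l IH].
  by rewrite !big_nil !mul1r.
by rewrite !big_cons -mulrA extmap_genM IH mulrA.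
Qed.

HB.instance Definition _ :=
  GRing.isMonoidMorphism.Build (ext T) (ext T') extmap
    extmap_is_monoid_morphism.

End ExteriorMap.

Section Circles.
Variables (T : finType) (e : rel T).

Definition adjacent : rel T := [rel x y | e x y || e y x].

Lemma adjacent_connect_sym : connect_sym adjacent.
Proof. by apply: sym_connect_sym => x y; rewrite /adjacent /= orbC. Qed.

(* A disjoint union of circles is given by points on it and by the pairs of
   points joined by an elementary piece of curve. A circle is represented by a
   distinguished point on it, and circ x is the circle through x. *)
Definition circle := {x : T | fingraph.roots adjacent x}.
HB.instance Definition _ := Finite.on circle.

Definition circ (x : T) : circle :=
  exist _ (fingraph.root adjacent x) (roots_root adjacent_connect_sym x).

Lemma circ_eq x y : (circ x == circ y) = connect adjacent x y.
Proof. by rewrite -val_eqE /= root_connect //; apply: adjacent_connect_sym. Qed.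

Lemma circ_val D : circ (val D) = D.
Proof. by apply: val_inj; apply/eqP; apply: (valP D). Qed.

End Circles.

Definition OF (T : finType) (e : rel T) := ext (circle e).
HB.instance Definition _ T e := GRing.NzRing.on (@OF T e).

Section Saddles.
Variables (T : finType) (e e' : rel T).

(* A saddle replaces the curves e by curves e' through the same points. *)
Definition merge_map : OF e -> OF e' := extmap (fun D => circ e' (val D)).

(* The circle of e through x splits into b1 -> b2, where b1 and b2 are the
   circles of e' through x and y. *)
Definition split_map (x y : T) (v : OF e) : OF e' :=
  (gen (circ e' x) - gen (circ e' y)) *
  extmap (fun D => if D == circ e x then circ e' x else circ e' (val D)) v.

End Saddles.

Section Matchings.
Variable n : nat.
Notation point := 'I_n.*2.

Definition crossingless (m : {ffun point -> point}) : bool :=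
  [&& [forall i : point, m (m i) == i], [forall i : point, m i != i] &
      [forall i : point, forall j : point,
         ~~ [&& i < j, j < m i & m i < m j]%N]].

Record matching := Matching {
  mate :> {ffun point -> point};
  mateP : crossingless mate }.
HB.instance Definition _ := [isSub for mate].
HB.instance Definition _ := [Finite of matching by <:].

(* W(b)a: i is joined to b i above the line and to a i below it. *)
Definition glued (b a : matching) : rel point :=
  [rel i j | (j == b i) || (j == a i)].

(* The diagram obtained from W(c)bW(b)a by contracting the arcs of b whose
   endpoints form S. The points inl i and inr i are the i-th points of the line
   between W(b) and a, and of the line between W(c) and b. *)
Definition stacked (c b a : matching) (S : {set point}) :
    rel (point + point)%type :=
  fun u v => match u, v with
  | inl i, inl j => (j == a i) || (i \notin S) && (j == b i)
  | inr i, inr j => (j == c i) || (i \notin S) && (j == b i)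
  | inl i, inr j | inr i, inl j => (i \in S) && (j == i)
  end.

(* The saddle contracting the arc {p, b p}, which creates vertical strands at p
   and b p. It splits a circle when the arc and its mirror image lie on the same
   circle, and is then oriented from the strand at p to the strand at b p. *)
Definition saddle_map (c b a : matching) (S : {set point}) (p : point) :
    OF (stacked c b a S) -> OF (stacked c b a (p |: (b p |: S))) :=
  if circ (stacked c b a S) (inl p) == circ (stacked c b a S) (inr p)
  then @split_map _ _ _ (inl p) (inl (b p))
  else @merge_map _ _ _.

Definition forget_line (u : point + point) : point :=
  match u with inl i | inr i => i end.

(* After the last saddle every point of one line is joined vertically to the
   same point of the other, and the diagram is identified with W(c)a. *)
Fixpoint cobordism_map (c b a : matching) (S : {set point}) (s : seq point) :
    OF (stacked c b a S) -> OF (glued c a) :=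
  match s with
  | [::] => extmap (fun D => circ (glued c a) (forget_line (val D)))
  | p :: s' => fun v => cobordism_map s' (saddle_map p v)
  end.

Definition surrounds (b : matching) (p q : point) : bool :=
  ((minn p (b p) < minn q (b q)) && (maxn q (b q) < maxn p (b p)))%N.

(* A chronology lists, in the order of the saddles, one endpoint p of each arc
   of b; the choice of p orients the saddle from the strand at p to the strand
   at b p. The orientation of a merge has no effect. *)
Record chronology (b : matching) := Chronology {
  saddles : seq point;
  saddles_perm : perm_eq (saddles ++ [seq b p | p <- saddles]) (enum point);
  saddles_outer_first : pairwise (fun p q => ~~ surrounds b q p) saddles }.

Definition choices := forall c b a : matching, chronology b.

Definition OH := forall b a : matching, OF (glued b a).

(* x /\ y, where x lies on W(c)b and y on W(b)a. *)
Definition juxtapose (c b a : matching) (x : OF (glued c b))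
    (y : OF (glued b a)) : OF (stacked c b a set0) :=
  extmap (fun D => circ (stacked c b a set0) (inr (val D))) x *
  extmap (fun D => circ (stacked c b a set0) (inl (val D))) y.

(* The product of the summands d(OH)c and b(OH)a is zero for c != b, so only
   the terms with a common middle matching remain. *)
Definition mulOH (C : choices) (x y : OH) : OH := fun c a =>
  \sum_(b : matching)
    cobordism_map (saddles (C c b a)) (juxtapose (x c b) (y b a)).

End Matchings.

(* Main.v *)
From HB Require Import structures.
Require Import Defs.
From mathcomp Require Import all_boot all_order all_algebra.
From mathcomp Require Import zify.

(** A split is multiplication on the left by an element of degree 1, so it
    anticommutes with left multiplication by a circle, while a merge commutes
    with it. Let the matchings [a] and [b] differ in exactly two arcs. Then the
    cobordism W(a)bW(b)a -> W(a)a has exactly one split, whatever the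
    chronology, and 1 * 1 = u - v up to sign in a(OH)a, where u and v are
    the two circles of W(a)a on which [a] and [b] differ. The cobordisms with
    W(a)a on top have merges only. Hence u (1 1) = u (u - v) = - u v, whereas
    (u 1) 1 = - w (u - v) with w = u or w = v, which is u v in both cases. *)

Set Implicit Arguments.
Unset Strict Implicit.
Unset Printing Implicit Defensive.

Import GRing.Theory.
Local Open Scope ring_scope.

(** * Signs in the exterior algebra, and separation of circles *)

Lemma gen_mul_neq_opp (T : finType) (u v : T) :
  u != v -> gen u * gen v != - (gen u * gen v).
Proof.
move=> nuv; rewrite ebaseM disjoints1 inE nuv.
(* The coefficient at {u, v} is 1 or -1, and neither equals its opposite in the integers. *)
apply/eqP=> /ffunP/(_ ([set u] :|: [set v])); rewrite [RHS]ffunE ffunMzE ffunE.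
by rewrite eqxx mulrzz mul1r -signr_odd; case: odd.
Qed.

Lemma extmap_genB (T T' : finType) (f : T -> T') s t :
  extmap f (gen s - gen t) = gen (f s) - gen (f t).
Proof. by rewrite raddfB /= !extmap_gen. Qed.

Section Circles.
Variables (T : finType) (e : rel T).

(** This serves to show that two points lie on different circles: it suffices to find a function
    constant along edges that takes different values at them. *)
Lemma circ_invariant (K : eqType) (f : T -> K) :
  (forall x y, e x y -> f x = f y) ->
  forall x y, circ e x = circ e y -> f x = f y.
Proof.
move=> fe x y /eqP; rewrite circ_eq => /connectP[l].
elim: l x => [|z l IH] x /=.
  by move=> _ ->.
by case/andP=> /orP[/fe ->|/fe <-] pl yl; apply: IH.
Qed.

Lemma circ_edge x y : e x y -> circ e x = circ e y.
Proof.
by move=> exy; apply/eqP; rewrite circ_eq; apply: connect1; apply/orP; left.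
Qed.

End Circles.

(** * Cobordism maps: passing a circle through them, and runs of merges *)

Section Cobordisms.
Variable n : nat.
Notation point := 'I_n.*2.
Implicit Types (a b c : matching n) (S : {set point}) (s : seq point).

Lemma mateK a : involutive a.
Proof. by case/and3P: (mateP a) => /forallP h _ _ i; apply/eqP. Qed.

Lemma mate_neq a i : a i != i.
Proof. by case/and3P: (mateP a) => _ /forallP h _. Qed.

Fixpoint splits c b a S s : nat :=
  if s is p :: s' then
    ((circ (stacked c b a S) (inl p) == circ (stacked c b a S) (inr p)) +
     splits c b a (p |: (b p |: S)) s')%N
  else 0%N.

Lemma split_mapM (T : finType) (e e' : rel T) x y D v :
  @split_map T e e' x y (gen D * v) =
  - (gen (if D == circ e x then circ e' x else circ e' (val D)) *
     @split_map T e e' x y v).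
Proof.
rewrite /split_map rmorphM /= extmap_gen !mulrA -mulNr; congr (_ * _).
by rewrite mulrBl mulrBr opprB genC (genC (circ _ y)) opprK addrC.
Qed.

Lemma saddle_map_is_zmod_morphism c b a S p :
  zmod_morphism (@saddle_map n c b a S p).
Proof.
move=> x y; rewrite /saddle_map /split_map /Defs.merge_map.
by case: ifP => _; rewrite raddfB ?mulrBr.
Qed.

HB.instance Definition _ c b a S p :=
  GRing.isZmodMorphism.Build _ _ (@saddle_map n c b a S p)
    (@saddle_map_is_zmod_morphism c b a S p).

Lemma cobordism_map_is_zmod_morphism c b a S s :
  zmod_morphism (@cobordism_map n c b a S s).
Proof.
elim: s S => [|p s IH] S x y /=; first by rewrite raddfB.
by rewrite raddfB IH.
Qed.

HB.instance Definition _ c b a S s :=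
  GRing.isZmodMorphism.Build _ _ (@cobordism_map n c b a S s)
    (@cobordism_map_is_zmod_morphism c b a S s).

Section Invariant.
Variables (K : eqType) (k : point -> K).

(** At a point of [S] the diagram has a vertical strand between the two copies of that point, and
    [forget_line] identifies these copies. Hence [b] is constrained only outside [S]. *)
Lemma stacked_invariant c b a S :
  k \o c =1 k -> k \o a =1 k -> (forall i, i \notin S -> k (b i) = k i) ->
  forall u v, circ (stacked c b a S) u = circ (stacked c b a S) v ->
  k (forget_line u) = k (forget_line v).
Proof.
move=> kc ka kb; apply: circ_invariant => -[i|i] [j|j] /=.
- by case/orP=> [/eqP->|/andP[/kb <- /eqP->]] //; rewrite -[LHS]ka.
- by case/andP=> _ /eqP->.
- by case/andP=> _ /eqP->.
- by case/orP=> [/eqP->|/andP[/kb <- /eqP->]] //; rewrite -[LHS]kc.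
Qed.

(* When [x] lies on the circle being split, [y] may end up on either half: only
   the class of [x] under an invariant [k] of the diagram is tracked. *)
Lemma cobordism_map_gen c b a S s x :
  k \o c =1 k -> k \o a =1 k -> (forall i, i \notin S -> k (b i) = k i) ->
  exists2 y, k y = k (forget_line x) &
    forall v, cobordism_map s (gen (circ (stacked c b a S) x) * v) =
      (gen (circ (glued c a) y) * cobordism_map s v) *~
        (-1) ^+ splits c b a S s.
Proof.
move=> kc ka; elim: s S x => [|p s IH] S x kb /=.
  exists (forget_line (val (circ (stacked c b a S) x))).
    by apply: (stacked_invariant kc ka kb); rewrite circ_val.
  by move=> v; rewrite rmorphM /= extmap_gen mulr1z.
have kb' i : i \notin p |: (b p |: S) -> k (b i) = k i.
  by rewrite !inE !negb_or => /and3P[_ _]; apply: kb.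
rewrite /saddle_map; case: ifPn => [_|_].
- pose D := circ (stacked c b a S) x.
  (* The split sends the circle that it cuts to its half through [inl p]; any other circle keeps its
     representative. *)
  have [y ky yE] := IH _ (if D == circ (stacked c b a S) (inl p)
    then inl p else val D) kb'.
  exists y.
    rewrite ky; apply: (stacked_invariant kc ka kb).
    by case: eqP => [<-|_] //; rewrite circ_val.
  move=> v; rewrite split_mapM raddfN /= -/D -(fun_if (circ _)) yE.
  by rewrite exprS mulN1r mulrNz.
- have [y ky yE] := IH _ (val (circ (stacked c b a S) x)) kb'.
  exists y.
    by rewrite ky; apply: (stacked_invariant kc ka kb); rewrite circ_val.
  by move=> v; rewrite /Defs.merge_map rmorphM /= extmap_gen yE.
Qed.

End Invariant.

(** The state midway through a chronology: [S] holds the endpoints of the arcs already contracted,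
    and [s] lists one endpoint of each remaining arc. *)
Definition pending b S s :=
  uniq (s ++ [seq b p | p <- s]) /\
  forall i, (i \in S) = (i \notin s ++ [seq b p | p <- s]).

Lemma pending_cons b S p s : pending b S (p :: s) ->
  [/\ p \notin S, b p \notin S & pending b (p |: (b p |: S)) s].
Proof.
case=> us Ss; have /permPl E := perm_catCA s [:: b p] [seq b p | p <- s].
have {}Ss i : (i \in S) = (i \notin [:: p, b p & s ++ [seq b p | p <- s]]).
  by rewrite Ss !inE /= (perm_mem E).
move: us; rewrite /= (perm_mem E) (perm_uniq E) /=.
case/and3P=> ps bps us.
split; rewrite ?Ss ?inE ?eqxx ?orbT //; split=> // i.
rewrite !inE Ss !inE; have [->|_] /= := eqVneq i p.
  by case/norP: ps.
by have [->|_] := eqVneq i (b p).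
Qed.

Lemma pending_mate b S s i : pending b S s -> (b i \in S) = (i \in S).
Proof.
case=> _ Ss; have E j := mem_map (inv_inj (mateK b)) s j.
by rewrite !Ss !mem_cat E -(E (b i)) mateK orbC.
Qed.

Lemma pending_saddles b (C : chronology b) : pending b set0 (saddles C).
Proof.
case: C => s ps _ /=; split; first by rewrite (perm_uniq ps) enum_uniq.
by move=> i; rewrite inE (perm_mem ps) mem_enum.
Qed.

(** No strand starts in [A], so a circle through an upper copy of a point of [A] runs along arcs of
    [c] and [b] inside [A] and never reaches the lower line, where [inl p] lies. *)
Lemma saddle_merges c b a S (A : {pred point}) p :
  (forall i, (c i \in A) = (i \in A)) -> (forall i, (b i \in A) = (i \in A)) ->
  {in A, forall i, i \notin S} -> p \in A ->
  circ (stacked c b a S) (inl p) == circ (stacked c b a S) (inr p) = false.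
Proof.
move=> cA bA AS pA; apply/negP=> /eqP.
pose f (u : point + point) := if u is inr i then i \in A else false.
suff fe u v : stacked c b a S u v -> f u = f v.
  by move/(circ_invariant fe); rewrite /f pA.
case: u v => [i|i] [j|j] //=.
- by case/andP=> iS /eqP->; apply/esym/negP => /AS; rewrite iS.
- by case/andP=> iS _; apply/negP => /AS; rewrite iS.
- by case/orP=> [/eqP->|/andP[_ /eqP->]].
Qed.

(** The common arc of [c] and [b] closes up to a circle with the two points [p] and [b p] on the
    upper line. *)
Lemma arc_merges c b a S p :
  p \notin S -> b p \notin S -> c p = b p ->
  circ (stacked c b a S) (inl p) == circ (stacked c b a S) (inr p) = false.
Proof.
move=> pS bpS cbp; apply: (@saddle_merges _ _ _ _ (pred2 p (b p))) => [i|i|i|].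
- by rewrite !inE !(inv_eq (mateK c)) cbp -[c (b p)](congr1 c cbp) mateK orbC.
- by rewrite !inE !(inv_eq (mateK b)) mateK orbC.
- by rewrite !inE => /orP[/eqP->|/eqP->].
- by rewrite !inE eqxx.
Qed.

Lemma saddle_map1 c b a S p :
  circ (stacked c b a S) (inl p) == circ (stacked c b a S) (inr p) = false ->
  @saddle_map n c b a S p 1 = 1.
Proof. by rewrite /saddle_map => ->; rewrite /Defs.merge_map rmorph1. Qed.

(** Each remaining saddle absorbs a two-point circle formed by an arc of [b] and the same arc of
    [c]; merges are ring morphisms, hence fix 1. *)
Lemma cobordism_map_merges c b a S s :
  pending b S s -> (forall i, i \notin S -> c i = b i) ->
  splits c b a S s = 0%N /\ @cobordism_map n c b a S s 1 = 1.
Proof.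
elim: s S => [|p s IH] S /=; first by rewrite rmorph1.
case/pending_cons=> pS bpS Ss cb.
have m := arc_merges a pS bpS (cb _ pS).
rewrite m add0n saddle_map1 //; apply: IH => // i.
by rewrite !inE !negb_or => /and3P[_ _]; apply: cb.
Qed.

(** * Evaluating products in the odd arc algebra *)

Lemma glued_invariant (K : eqType) (k : point -> K) c a i :
  k \o c =1 k -> k \o a =1 k -> k (val (circ (glued c a) i)) = k i.
Proof.
move=> kc ka; apply: (@circ_invariant _ (glued c a)); last exact: circ_val.
by move=> u v /orP[] /eqP->; [rewrite -[LHS]kc|rewrite -[LHS]ka].
Qed.

Lemma juxtapose0l c b a y : @juxtapose n c b a 0 y = 0.
Proof.
exact: etrans (congr1 (fun v => v * _) (raddf0 (extmap _))) (mul0r _).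
Qed.

Lemma juxtapose0r c b a x : @juxtapose n c b a x 0 = 0.
Proof.
exact: etrans (congr1 (fun v => _ * v) (raddf0 (extmap _))) (mulr0 _).
Qed.

Lemma juxtapose11 c b a : @juxtapose n c b a 1 1 = 1.
Proof.
apply: etrans (congr1 (fun v => v * _) (rmorph1 (extmap _))) _.
exact: etrans (mul1r _) (rmorph1 (extmap _)).
Qed.

Lemma juxtapose_gen c b a D y : @juxtapose n c b a (gen D) y =
  gen (circ (stacked c b a set0) (inr (val D))) *
  extmap (fun D => circ (stacked c b a set0) (inl (val D))) y.
Proof. exact (congr1 (fun v => v * extmap _ y) (extmap_gen _ D)). Qed.

Lemma juxtapose_gen1 c b a D : @juxtapose n c b a (gen D) 1 =
  gen (circ (stacked c b a set0) (inr (val D))) * 1.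
Proof.
rewrite juxtapose_gen; congr (_ * _); exact: (rmorph1 (extmap _)).
Qed.

Lemma mulOHl (C : choices n) b (x y : OH n) c a :
  (forall d, d != b -> x c d = 0) ->
  mulOH C x y c a =
    cobordism_map (saddles (C c b a)) (juxtapose (x c b) (y b a)).
Proof.
move=> x0; rewrite /mulOH (bigD1 b) //= [X in _ + X]big1.
  exact: addr0.
move=> d /x0->.
by rewrite juxtapose0l; exact: raddf0.
Qed.

Lemma mulOHr (C : choices n) b (x y : OH n) c a :
  (forall d, d != b -> y d a = 0) ->
  mulOH C x y c a =
    cobordism_map (saddles (C c b a)) (juxtapose (x c b) (y b a)).
Proof.
move=> y0; rewrite /mulOH (bigD1 b) //= [X in _ + X]big1.
  exact: addr0.
move=> d /y0->.
by rewrite juxtapose0r; exact: raddf0.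
Qed.

(** * Two matchings that differ in two arcs *)

Section TwoArcs.
Variables a b : matching n.
(** Together the two hypotheses say that the points where [a] and [b] differ, if there are any, are
    the four points of a single circle of W(b)a. *)
Hypothesis abC : forall i, a (b i) = b (a i).
Hypothesis two_arcs : forall i j, a i != b i -> a j != b j ->
  j \in [:: i; a i; b i; a (b i)].

Let P := [pred i | a i != b i].

Let Pa i : (a i \in P) = (i \in P).
Proof.
by rewrite !inE -abC mateK eq_sym (inv_eq (mateK a)) [b i == _]eq_sym.
Qed.

Let Pb i : (b i \in P) = (i \in P).
Proof. by rewrite !inE mateK abC (inv_eq (mateK b)). Qed.

Let ka : circ (glued a a) \o a =1 circ (glued a a).
Proof. by move=> i; apply/esym/circ_edge; rewrite /glued /= eqxx. Qed.

(** Two arcs of [b] have endpoints in [P]. Whichever is contracted first merges the two four-point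
    circles on [P]; the second then splits the result, since the strands of the first already join
    the two lines. All other saddles contract arcs common to [a] and [b], hence merge. The point [r]
    witnesses that the split is still to come. *)
Lemma cobordism_map_two_arcs S s r :
  pending b S s -> a r != b r -> r \notin S ->
  splits a b a S s = 1%N /\
  exists2 p, a p != b p & @cobordism_map n a b a S s 1 =
     gen (circ (glued a a) p) - gen (circ (glued a a) (b p)).
Proof.
elim: s S r => [|p s IH] S r /=; first by case=> _ ->.
move=> Sps Pr rS; have [pS bpS Ss] := pending_cons Sps.
have [/negPn/eqP abp|Pp] := boolP (~~ (p \in P)).
  rewrite arc_merges // saddle_map1 ?arc_merges //; apply: (IH _ r) => //.
  rewrite !inE (negPf rS) orbF; apply/norP; split.
    by apply: contraNneq Pr => ->; rewrite abp.
  by apply: contraNneq Pr => ->; rewrite mateK -abp mateK.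
rewrite negbK in Pp.
have [/existsP[q /andP[qS Pq]]|nSP] := boolP [exists q, (q \in S) && (q \in P)].
  have abS : (a p \in S) /\ (a (b p) \in S).
    rewrite abC (pending_mate _ Sps).
    have := two_arcs Pp Pq; rewrite !inE => /or4P[] /eqP qE; rewrite qE in qS.
    - by rewrite qS in pS.
    - by [].
    - by rewrite qS in bpS.
    - by move: qS; rewrite abC (pending_mate _ Sps).
  have spl : circ (stacked a b a S) (inl p) == circ (stacked a b a S) (inr p).
    apply/eqP; rewrite (@circ_edge _ _ (inl p) (inl (a p))) /= ?eqxx //.
    rewrite (@circ_edge _ _ (inl (a p)) (inr (a p))) /= ?eqxx ?andbT //;
      last by case: abS.
    by apply: circ_edge; rewrite /= mateK eqxx.
  have ab' i : i \notin p |: (b p |: S) -> a i = b i.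
    rewrite !inE !negb_or => /and3P[ip ibp iS]; apply/eqP; apply: contraNT iS.
    move/(two_arcs Pp); rewrite !inE (negPf ip) (negPf ibp) /=.
    by case/orP=> /eqP->; case: abS.
  have [spl0 F1] := cobordism_map_merges a Ss ab'.
  (* After the split [b] agrees with [a] on the remaining arcs, so the circle of W(a)a is itself an
     invariant, and it determines where both halves end up. *)
  have kb i : i \notin p |: (b p |: S) ->
      circ (glued a a) (b i) = circ (glued a a) i.
    by move/ab' <-; apply: ka.
  rewrite spl spl0; split=> //; exists p => //.
  have [y yp Fp] := cobordism_map_gen s (inl p) ka ka kb.
  have [z zp Fbp] := cobordism_map_gen s (inl (b p)) ka ka kb.
  rewrite /saddle_map spl /split_map rmorph1 mulr1 raddfB /=.
  rewrite -[gen (circ _ (inl p))]mulr1 -[gen (circ _ (inl (b p)))]mulr1.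
  by rewrite Fp Fbp spl0 F1 !mulr1z !mulr1 yp zp.
have m :
  circ (stacked a b a S) (inl p) == circ (stacked a b a S) (inr p) = false.
  apply: (saddle_merges _ Pa Pb) => // i Pi; apply: contra nSP => iS.
  by apply/existsP; exists i; rewrite iS.
rewrite m saddle_map1 //; apply: (IH _ (a p)) => //.
  exact: etrans (Pa p) Pp.
rewrite !inE (negPf (mate_neq a p)) (negPf Pp) /=.
apply: contra nSP => apS; apply/existsP.
by exists (a p); rewrite apS Pa.
Qed.

Lemma not_associative_two_arcs (C : choices n) r :
  a r != b r -> ~ associative (mulOH C).
Proof.
move=> Pr assocC; have Sba := pending_saddles (C a b a).
have r0 : r \notin set0 by rewrite inE.
have [spl [p Pp F1]] := cobordism_map_two_arcs Sba Pr r0.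
pose x : OH n := fun c d => gen (circ (glued c d) p) *+ ((c == a) && (d == a)).
pose y : OH n := fun c d => 1 *+ ((c == a) && (d == b)).
pose z : OH n := fun c d => 1 *+ ((c == b) && (d == a)).
have xE : x a a = gen (circ (glued a a) p) by rewrite /x !eqxx; exact: mulr1n.
have yE : y a b = 1 by rewrite /y !eqxx; exact: mulr1n.
have zE : z b a = 1 by rewrite /z !eqxx; exact: mulr1n.
have x0 d : d != a -> x a d = 0.
  by move/negPf; rewrite /x eqxx => ->; exact: mulr0n.
have y0 d : d != b -> y a d = 0.
  by move/negPf; rewrite /y eqxx => ->; exact: mulr0n.
have z0 d : d != b -> z d a = 0.
  by move/negPf; rewrite /z eqxx andbT => ->; exact: mulr0n.
have yzE : mulOH C y z a a =
    gen (circ (glued a a) p) - gen (circ (glued a a) (b p)).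
  rewrite (mulOHl _ _ _ y0) yE zE juxtapose11; exact: F1.
have xyzE : mulOH C x (mulOH C y z) a a = gen (circ (glued a a) p) *
    (gen (circ (glued a a) p) - gen (circ (glued a a) (b p))).
  rewrite (mulOHl _ _ _ x0) yzE xE juxtapose_gen extmap_genB.
  have [spl0 G1] := cobordism_map_merges a (pending_saddles (C a a a))
    (fun _ _ => erefl).
  (* This cobordism has merges only, and the invariant is again the circle of W(a)a, so no choice of
     representative remains. *)
  have gE t v : cobordism_map (saddles (C a a a))
      (gen (circ (stacked a a a set0) t) * v) =
      gen (circ (glued a a) (forget_line t)) *
      cobordism_map (saddles (C a a a)) v.
    have [w wt ->] := @cobordism_map_gen _ _ a a a set0
      (saddles (C a a a)) t ka ka (fun i _ => ka i).
    rewrite wt spl0; exact: mulr1z.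
  have gE1 t : cobordism_map (saddles (C a a a))
      (gen (circ (stacked a a a set0) t)) =
      gen (circ (glued a a) (forget_line t)).
    by have := gE t 1; rewrite G1 !mulr1.
  rewrite gE (raddfB (cobordism_map _)) /= !gE1.
  by congr (gen _ * (gen _ - gen _)); rewrite -[RHS]circ_val.
(* In W(a)b the points of [P] form one circle, so membership in [P] is the invariant to track. *)
have [w Pw xyE] : exists2 w, w \in P &
    mulOH C x y a b = gen (circ (glued a b) w).
  rewrite (mulOHl _ _ _ x0) xE yE juxtapose_gen1.
  have [w wp ->] := @cobordism_map_gen _ _ a a b set0
    (saddles (C a a b)) (inr (val (circ (glued a a) p)))
    Pa Pb (fun i _ => Pa i).
  have [-> ->] := cobordism_map_merges b (pending_saddles (C a a b))
    (fun _ _ => erefl).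
  exists w; last exact: etrans (mulr1z _) (mulr1 _).
  exact: etrans wp (etrans (glued_invariant p Pa Pa) Pp).
(* The sign comes from the single split. Which half receives the circle depends on the chronology,
   so only membership in [P] is kept. *)
have [w' Pw' xyz'E] : exists2 w', w' \in P & mulOH C (mulOH C x y) z a a =
    - (gen (circ (glued a a) w') *
      (gen (circ (glued a a) p) - gen (circ (glued a a) (b p)))).
  rewrite (mulOHr _ _ _ z0) xyE zE juxtapose_gen1.
  have [w' wp ->] := @cobordism_map_gen _ _ a b a set0
    (saddles (C a b a)) (inr (val (circ (glued a b) w)))
    Pa Pa (fun i _ => Pb i).
  exists w'; first exact: etrans wp (etrans (glued_invariant w Pa Pb) Pw).
  rewrite F1 spl; exact: mulrN1z.
have nuv : circ (glued a a) p != circ (glued a a) (b p).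
  apply/eqP=> E.
  (* Circles of W(a)a have two points each, and [b p] is neither [p] nor [a p]. *)
  pose f i := i \in pred2 p (a p).
  have fa i j : glued a a i j -> f i = f j.
    rewrite /glued /= orbb => /eqP->.
    by rewrite /f !inE !(inv_eq (mateK a)) mateK orbC.
  have := circ_invariant fa E; rewrite /f.
  by rewrite !inE eqxx (negPf (mate_neq b p)) [b p == _]eq_sym (negPf Pp).
have := congr1 (fun f : OH n => f a a) (assocC x y z).
(* With u and v the circles through [p] and [b p], and w' standing for its circle, associativity now
   reads u v = w' (u - v). *)
rewrite xyzE xyz'E mulrBr gen_sq sub0r => /oppr_inj.
have : circ (glued a a) w' = circ (glued a a) p \/
       circ (glued a a) w' = circ (glued a a) (b p).
  have := two_arcs Pp Pw'; rewrite !inE.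
  by case/or4P=> /eqP->; rewrite ?[circ _ (a _)]ka; auto.
case=> ->; rewrite mulrBr gen_sq ?sub0r ?subr0 => /eqP.
  by rewrite (negPf (gen_mul_neq_opp nuv)).
by rewrite genC eqr_oppLR (negPf (gen_mul_neq_opp _)) // eq_sym.
Qed.

End TwoArcs.
End Cobordisms.

(** * Existence of such a pair of matchings *)

Lemma crossingless_nat n (f : nat -> nat) (m : {ffun 'I_n.*2 -> 'I_n.*2}) :
  (forall i, m i = f i :> nat) ->
  (forall i, f (f i) = i) -> (forall i, f i <> i) ->
  (forall i j, ~ [&& i < j, j < f i & f i < f j]%N) -> crossingless m.
Proof.
move=> mf fK fn fc; apply/and3P; split.
- by apply/forallP=> i; apply/eqP/val_inj; rewrite /= !mf.
- by apply/forallP=> i; apply/eqP=> /(congr1 val) /=; rewrite mf; apply: fn.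
- by apply/forallP=> i; apply/forallP=> j; rewrite !mf; apply/negP/fc.
Qed.

Lemma exists_two_arcs n : (2 <= n)%N -> exists a b : matching n,
  [/\ forall i, a (b i) = b (a i),
      forall i j, a i != b i -> a j != b j ->
        j \in [:: i; a i; b i; a (b i)] &
      exists r, a r != b r].
Proof.
(* [f] joins each even point 2k to 2k + 1. [g] replaces the first two of these arcs by the nested
   arcs {0, 3} and {1, 2}. *)
move=> n2; pose f i := (i + 1 - (i %% 2).*2)%N.
pose g i := if (i < 4)%N then (3 - i)%N else f i.
have f_lt (i : 'I_n.*2) : (f i < n.*2)%N by rewrite /f; case: i => i /=; lia.
have g_lt (i : 'I_n.*2) : (g i < n.*2)%N.
  by rewrite /g; case: ifP (f_lt i) => // _ _; lia.
pose fa := [ffun i => Ordinal (f_lt i)].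
pose gb := [ffun i => Ordinal (g_lt i)].
have faE i : fa i = f i :> nat by rewrite ffunE.
have gbE i : gb i = g i :> nat by rewrite ffunE.
have ca : crossingless fa.
  by apply: (crossingless_nat faE) => [i|i|i j]; rewrite /f; lia.
have cb : crossingless gb.
  apply: (crossingless_nat gbE) => [i|i|i j]; rewrite /g /f.
  - case: (ltnP i 4) => i4; last by rewrite ifF; lia.
    by rewrite ifT; lia.
  - by case: (ltnP i 4) => i4; lia.
  - by case: (ltnP i 4) => i4; case: (ltnP j 4) => j4; lia.
exists (Matching ca), (Matching cb); split=> [i|i j|] /=.
- apply: val_inj; rewrite /= faE !gbE faE /g /f.
  by case: (ltnP i 4) => i4; [rewrite ifT|rewrite ifF]; lia.
- rewrite !inE -!val_eqE /= !faE !gbE /g.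
  case: (ltnP i 4) => i4; last by rewrite eqxx.
  case: (ltnP j 4) => j4; last by rewrite eqxx.
  by rewrite /f; lia.
- have n0 : (0 < n.*2)%N by lia.
  by exists (Ordinal n0); rewrite -val_eqE /= faE gbE.
Qed.

Theorem proposition3p2 (n : nat) (hn : (2 <= n)%N) (C : choices n) :
  ~ associative (mulOH C).
Proof.
have [a [b [abC two_arcs [r Pr]]]] := exists_two_arcs hn.
exact: not_associative_two_arcs Pr.
Qed.
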